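(* Let $G=(V,E)$ and $H=(U,W)$ be graphs with adjacency matrices $M$ and $L$. Let $P$ be a perfect coloring of $G$ in $k_1$ colors with parameter matrix $S$, and $R$ a perfect coloring of $H$ in $k_2$ colors with parameter matrix $T$, and let $l_1,\dots,l_{k_2}$ be the numbers of vertices of each color in the coloring $R$. Then $P\otimes R$ is a perfect coloring in $k_1k_2$ colors of the lexicographic product $G\cdot H$ (adjacency matrix $M\otimes J_{|U|}+I_{|V|}\otimes L$) with parameter matrix $$S\otimes\big(J_{k_2}\cdot {\rm diag}(l_1,\dots,l_{k_2})\big)+I_{k_1}\otimes T.$$
   Context: A perfect coloring of a graph with $n$ vertices and adjacency matrix $M$ in $k$ colors is given by an $n\times k$ $(0,1)$-matrix $P$ with exactly one entry $1$ in each row and no zero column (the coloring vertex $\mapsto$ color), such that $MP=PS$ for some $k\times k$ matrix $S$, called the parameter matrix (its entry $s_{i,j}$ is the number of neighbors of color $j$ of any vertex of color $i$). $J_r$ is the $r\times r$ all-ones matrix, $I_r$ the identity matrix, ${\rm diag}$ a diagonal matrix, $\otimes$ the Kronecker product. *)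

(* Defs.v *)
From mathcomp Require Import all_boot all_order all_algebra.
From mathcomp Require Export mxtens.

Set Implicit Arguments.
Unset Strict Implicit.
Unset Printing Implicit Defensive.

Import GRing.Theory Num.Theory.
Local Open Scope ring_scope.

(* Finite simple graph; the vertex set is numbered, as is implicit whenever
   one speaks of its adjacency matrix. *)
Record sgraph (n : nat) := SGraph {
  adj :> rel 'I_n;
  adj_sym : symmetric adj;
  adj_irr : irreflexive adj }.

Definition adjmx (K : pzRingType) (n : nat) (G : sgraph n) : 'M[K]_n :=
  \matrix_(i, j) (adj G i j)%:R.

Section LexProd.

Variables (n m : nat) (G : sgraph n) (H : sgraph m).

(* The vertex x of the product is the pair mxtens_unindex x in 'I_n * 'I_m;
   this is the numbering of pairs used by the Kronecker product tensmx. *)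
Definition lex_adj : rel 'I_(n * m) := fun x y =>
  let: (v, u) := mxtens_unindex x in
  let: (v', u') := mxtens_unindex y in
  adj G v v' || ((v == v') && adj H u u').

Lemma lex_adj_sym : symmetric lex_adj.
Proof.
move=> x y; rewrite /lex_adj.
case: (mxtens_unindex x) => v u; case: (mxtens_unindex y) => v' u'.
by rewrite adj_sym (eq_sym v) (adj_sym H).
Qed.

Lemma lex_adj_irr : irreflexive lex_adj.
Proof.
move=> x; rewrite /lex_adj; case: (mxtens_unindex x) => v u.
by rewrite !adj_irr andbF.
Qed.

Definition lexprod : sgraph (n * m) := SGraph lex_adj_sym lex_adj_irr.

End LexProd.

Definition coloring_mx (K : pzRingType) (n k : nat) (P : 'M[K]_(n, k)) : Prop :=
  [/\ forall i j, P i j = 0 \/ P i j = 1,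
      forall i, exists! j, P i j = 1
    & forall j, col j P != 0].

Definition perfect_coloring (K : pzRingType) (n k : nat)
    (G : sgraph n) (P : 'M[K]_(n, k)) (S : 'M[K]_k) : Prop :=
  coloring_mx P /\ adjmx K G *m P = P *m S.

Definition color_size (K : pzRingType) (n k : nat)
    (P : 'M[K]_(n, k)) (j : 'I_k) : nat := #|[set i | P i j == 1]|.

(* Main.v *)
(** Since [G] is loopless, the two ways of being adjacent in the lexicographic
    product exclude each other, which gives the formula for its adjacency
    matrix. For the parameter matrix, by the mixed-product rule it suffices
    that [J *m R = R *m (J *m diag l)]: both sides have all rows equal to [l],
    the left one by counting the ones in the columns of [R], the right one
    because the rows of [R] sum to [1]. *)
Require Import Defs.
From mathcomp Require Import all_boot all_order all_algebra.
From mathcomp Require Import mxtens.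

Import GRing.Theory Num.Theory.
Local Open Scope ring_scope.

Lemma adjmx_lexprod (K : pzRingType) (n m : nat) (G : sgraph n) (H : sgraph m) :
  adjmx K (lexprod G H) = adjmx K G *t (const_mx 1 : 'M[K]_m)
                          + (1%:M : 'M[K]_n) *t adjmx K H.
Proof.
apply/matrixP => x y.
case: (mxtens_indexP x) => v u; case: (mxtens_indexP y) => v' u'.
rewrite [LHS]mxE [RHS]mxE !tensmxE !mxE mulr1 /= /lex_adj !mxtens_indexK.
case: eqVneq => [<-|_]; first by rewrite adj_irr add0r mul1r.
by rewrite orbF mul0r addr0.
Qed.

Lemma coloring_row_sum (K : pzRingType) (n k : nat) (P : 'M[K]_(n, k)) i :
  coloring_mx P -> \sum_j P i j = 1.
Proof.
case=> P01 P1 _; have [j [Pij uniq_j]] := P1 i.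
rewrite (bigD1 j) //= Pij big1 ?addr0 // => j' j'j.
(* An entry [1] at [j'] would force [j' = j] by uniqueness, so every other entry of the row is
   [0]. *)
by case: (P01 i j') => // /uniq_j jj'; rewrite jj' eqxx in j'j.
Qed.

(** Since [1 != 0] in [K], the test [P i j == 1] fails exactly on the zero entries, so each entry is
    the indicator of the color class. *)
Lemma coloring_col_sum (K : nzRingType) (n k : nat) (P : 'M[K]_(n, k)) j :
  coloring_mx P -> \sum_i P i j = (color_size P j)%:R.
Proof.
case=> P01 _ _; rewrite /color_size -sum1_card natr_sum [RHS]big_mkcond /=.
apply: eq_bigr => i _; rewrite inE.
by case: (P01 i j) => ->; rewrite ?eqxx // eq_sym oner_eq0.
Qed.

Lemma const1_mul_coloring (K : nzRingType) (n k : nat) (P : 'M[K]_(n, k)) :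
  coloring_mx P ->
  (const_mx 1 : 'M[K]_n) *m P
  = P *m ((const_mx 1 : 'M[K]_k)
            *m diag_mx (\row_j (color_size P j)%:R)).
Proof.
move=> colP; apply/matrixP => i j; rewrite mul_mx_diag !mxE.
under eq_bigr do rewrite mxE mul1r.
under [RHS]eq_bigr do rewrite !mxE mul1r.
by rewrite -mulr_suml coloring_row_sum // mul1r coloring_col_sum.
Qed.

(** The pair [(v, u)] receives the pair of the colors of [v] and [u]. *)
Lemma coloring_tens (K : idomainType) (n m k1 k2 : nat)
    (P : 'M[K]_(n, k1)) (R : 'M[K]_(m, k2)) :
  coloring_mx P -> coloring_mx R -> coloring_mx (P *t R).
Proof.
move=> [P01 P1 Pn0] [R01 R1 Rn0]; split=> [x y|x|y].
- rewrite mxE; case: (P01 (mxtens_unindex x).1 (mxtens_unindex y).1) => ->.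
    by left; rewrite mul0r.
  by rewrite mul1r.
- case: (mxtens_indexP x) => v u.
  have [i [Pvi uniq_i]] := P1 v; have [j [Ruj uniq_j]] := R1 u.
  exists (mxtens_index (i, j)); split; first by rewrite tensmxE Pvi Ruj mulr1.
  move=> y; case: (mxtens_indexP y) => i' j'; rewrite tensmxE => PR1.
  (* A product equal to [1] has no zero factor, so the [0]/[1] entry of [P] is [1], and then so is
     that of [R]. *)
  case: (P01 v i') => Pvi'.
    by move/eqP: PR1; rewrite Pvi' mul0r eq_sym oner_eq0.
  by move: PR1; rewrite Pvi' mul1r => /uniq_j ->; rewrite (uniq_i _ Pvi').
- case: (mxtens_indexP y) => i j.
  have /matrix0Pn[v [z Pvi]] := Pn0 i; have /matrix0Pn[u [t Ruj]] := Rn0 j.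
  (* The [0] is the only column index of the one-column matrix [col]. *)
  apply/matrix0Pn; exists (mxtens_index (v, u)), 0.
  by move: Pvi Ruj; rewrite !mxE !mxtens_indexK; apply: mulf_neq0.
Qed.

Theorem theorem19 (K : numDomainType) (n m k1 k2 : nat)
    (G : sgraph n) (H : sgraph m)
    (P : 'M[K]_(n, k1)) (S : 'M[K]_k1) (R : 'M[K]_(m, k2)) (T : 'M[K]_k2) :
  perfect_coloring G P S ->
  perfect_coloring H R T ->
  adjmx K (lexprod G H) = adjmx K G *t (const_mx 1 : 'M[K]_m)
                          + (1%:M : 'M[K]_n) *t adjmx K H
  /\ perfect_coloring (lexprod G H) (P *t R)
       (S *t ((const_mx 1 : 'M[K]_k2)
                *m diag_mx (\row_j (color_size R j)%:R))
        + (1%:M : 'M[K]_k1) *t T).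
Proof.
move=> [colP MP] [colR LR]; split; first exact: adjmx_lexprod.
split; first exact: coloring_tens.
(* Both sides become [(P *m S) *t X + P *t (R *m T)], differing only in the factor [X]. *)
rewrite adjmx_lexprod mulmxDl mulmxDr !tensmx_mul MP LR mul1mx mulmx1.
by rewrite const1_mul_coloring.
Qed.
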